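(* Let $S:\mathcal{E}\to\mathcal{E}$ be a random subshift of finite type over an invertible ergodic measure preserving system $(\Omega,\theta,\mathbb{P})$, with $S$-invariant probability measure $\nu$ with marginal $\mathbb{P}$ on $\Omega$, sample measures $(\mu_\omega)_{\omega\in\Omega}$ and marginal $\mu=\int\mu_\omega\,d\mathbb{P}$ on $X$. Assume that there are a constant $a\in[0,1)$ and a function $\alpha$ with $\alpha(g)=\mathcal{O}(a^g)$ such that for all $n,m,g$ and all $A\in\mathcal{F}_0^n(X)$, $B\in\mathcal{F}_0^m(X)$: (1) $\left|\mu(A\cap\sigma^{-g-n}A)-\mu(A)^2\right|\le\alpha(g)$; (2) for $\mathbb{P}$-almost every $\omega\in\Omega$, $\left|\mu_\omega(A\cap\sigma^{-g-n}B)-\mu_\omega(A)\,\mu_{\theta^{n+g}\omega}(B)\right|\le\alpha(g)$. If $0<\underline{H}_2(\mu)\le 2h_0$, then for $\mathbb{P}$-almost every $\omega\in\Omega$, $$\limsup_{n\to\infty}\frac{M_n(x,y)}{\log n}\le\frac{2}{\underline{H}_2(\mu)}\quad\text{for }\mu_\omega\otimes\mu_\omega\text{-almost every }(x,y)\in\mathcal{E}_\omega\times\mathcal{E}_\omega.$$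
   Context: Random subshift of finite type. $\mathbb{N}=\{0,1,2,\dots\}$. Let $(\Omega,\theta,\mathbb{P})$ be an invertible ergodic (probability) measure preserving system, $N\ge1$ an integer, $X=\{1,\dots,N\}^{\mathbb{N}}$ and $\sigma:X\to X$ the shift. Let $b:\Omega\to\{1,\dots,N\}$ be a random variable and let $A(\omega)=(a_{ij}(\omega))$, $\omega\in\Omega$, be a random transition matrix: $A(\omega)$ is a $b(\omega)\times b(\theta\omega)$ matrix with entries in $\{0,1\}$, with at least one non-zero entry in each row and each column, and $\omega\mapsto a_{ij}(\omega)$ is measurable for all $i,j$. Put $X_\omega=\{1,\dots,b(\omega)\}$, $$\mathcal{E}_\omega=\{x=(x_0,x_1,\dots):x_i\in X_{\theta^i\omega}\text{ and }a_{x_ix_{i+1}}(\theta^i\omega)=1\text{ for all }i\in\mathbb{N}\}\subset X,$$ $$\mathcal{E}=\{(\omega,x):\omega\in\Omega,\ x\in\mathcal{E}_\omega\}\subset\Omega\times X,\qquad S(\omega,x)=(\theta\omega,\sigma x).$$ Let $\nu$ be an $S$-invariant probability measure on $\mathcal{E}$ with marginal $\mathbb{P}$ on $\Omega$, and let $(\mu_\omega)_\omega$ be its decomposition, $d\nu(\omega,x)=d\mu_\omega(x)\,d\mathbb{P}(\omega)$; the $\mu_\omega$ are the sample measures, viewed as probability measures on $X$ giving full mass to $\mathcal{E}_\omega$. Let $\mu=\int\mu_\omega\,d\mathbb{P}$ be the marginal of $\nu$ on $X$. Cylinders. For $y\in X$, $C_n(y)=\{z\in X:z_i=y_i\text{ for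 }0\le i\le n-1\}$ is the $n$-cylinder containing $y$; $\mathcal{F}_0^n(X)$ is the sigma-algebra on $X$ generated by all $n$-cylinders. Longest common substring. For $x,y\in X$, $$M_n(x,y)=\max\{m:x_{i+k}=y_{j+k}\text{ for }k=1,\dots,m\text{ and for some }0\le i,j\le n-m\}.$$ Entropies. With sums and maxima taken over all $k$-cylinders $C_k$, $$\underline{H}_2(\mu)=\liminf_{k\to\infty}\frac{\log\sum\mu(C_k)^2}{-k},\qquad h_0=\liminf_{k\to\infty}\frac{\log\int_\Omega\max_{C_k}\mu_\omega(C_k)\,d\mathbb{P}}{-k}.$$ *)

(* Defs.v *)
From HB Require Import structures.
From mathcomp Require Import all_boot all_order all_algebra.
From mathcomp Require Import all_classical all_reals all_analysis.
From mathcomp Require Import measurable_realfun.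
Set Implicit Arguments.
Unset Strict Implicit.
Unset Printing Implicit Defensive.
Import Order.TTheory GRing.Theory Num.Theory.
Import numFieldNormedType.Exports.
Local Open Scope classical_set_scope.
Local Open Scope ring_scope.

HB.instance Definition _ (p : nat) := isPointed.Build 'I_p.+1 ord0.

(* The alphabet has size N = p.+1 >= 1; the letter l of {1, ..., N} is
   represented by the ordinal of value l - 1. *)
Definition cylinder (p n : nat) (y : nat -> 'I_p.+1) : set (nat -> 'I_p.+1) :=
  [set z | forall i, (i < n)%N -> z i = y i].

Definition cylinders (p n : nat) : set (set (nat -> 'I_p.+1)) :=
  range (@cylinder p n).

(* The sigma-algebra generated by the cylinders is the product one. *)
Definition shift_space (p : nat) :=
  g_sigma_algebraType (\bigcup_n (@cylinders p n)).

HB.instance Definition _ (p : nat) := Measurable.on (shift_space p).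

Definition F0 (p n : nat) : set (set (shift_space p)) := <<s @cylinders p n >>.

Definition left_shift (p : nat) (x : shift_space p) : shift_space p :=
  fun i => x i.+1.

(* The k-cylinder of a word; the padding of the word after position k is
   irrelevant, and distinct words have distinct k-cylinders, so that the
   k-cylinders are in bijection with the k-tuples. *)
Definition word_cylinder (p k : nat) (u : k.-tuple 'I_p.+1) :
    set (shift_space p) :=
  cylinder k (nth ord0 u).

Record invertible_ergodic (d : measure_display) (Omega : measurableType d)
    (R : realType) (P : probability Omega R) (theta : Omega -> Omega) : Prop :=
  InvertibleErgodic {
    measurable_base : measurable_fun setT theta ;
    invertible_base : exists2 thetaV : Omega -> Omega,
      measurable_fun setT thetaV & cancel theta thetaV /\ cancel thetaV theta ;
    preserving_base : forall A, measurable A -> P (theta @^-1` A) = P A ;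
    ergodic_base : forall A, measurable A -> theta @^-1` A = A ->
      P A = 0%E \/ P A = 1%E }.

(* The b(w) x b(theta w) matrix A(w) is the upper left block of a w, with
   true standing for 1 and false for 0; the entries of a w outside of this
   block play no role. *)
Record random_transition_matrix (d : measure_display)
    (Omega : measurableType d) (p : nat) (theta : Omega -> Omega)
    (b : Omega -> nat) (a : Omega -> 'M[bool]_p.+1) : Prop :=
  RandomTransitionMatrix {
    measurable_alphabet : measurable_fun setT b ;
    alphabet_bounds : forall w, (1 <= b w <= p.+1)%N ;
    measurable_entries : forall i j : 'I_p.+1,
      measurable_fun [set w | (i < b w)%N /\ (j < b (theta w))%N]
        (fun w => a w i j) ;
    nonzero_rows : forall w (i : 'I_p.+1), (i < b w)%N ->
      exists2 j : 'I_p.+1, (j < b (theta w))%N & a w i j ;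
    nonzero_columns : forall w (j : 'I_p.+1), (j < b (theta w))%N ->
      exists2 i : 'I_p.+1, (i < b w)%N & a w i j }.

Definition fiber (Omega : Type) (p : nat) (theta : Omega -> Omega)
    (b : Omega -> nat) (a : Omega -> 'M[bool]_p.+1) (w : Omega) :
    set (shift_space p) :=
  [set x : shift_space p | forall i, (x i < b (iter i theta w))%N /\
     a (iter i theta w) (x i) (x i.+1)].

Definition bundle (Omega : Type) (p : nat) (theta : Omega -> Omega)
    (b : Omega -> nat) (a : Omega -> 'M[bool]_p.+1) :
    set (Omega * shift_space p) :=
  [set z | fiber theta b a z.1 z.2].

Definition skew_shift (Omega : Type) (p : nat) (theta : Omega -> Omega)
    (z : Omega * shift_space p) : Omega * shift_space p :=
  (theta z.1, left_shift z.2).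

Record invariant_with_marginal (d : measure_display)
    (Omega : measurableType d) (R : realType) (P : probability Omega R)
    (p : nat) (theta : Omega -> Omega) (b : Omega -> nat)
    (a : Omega -> 'M[bool]_p.+1)
    (nu : probability (Omega * shift_space p)%type R) : Prop :=
  InvariantWithMarginal {
    carried_by_bundle : nu (bundle theta b a) = 1%E ;
    skew_shift_invariant : forall B, measurable B ->
      nu (skew_shift theta @^-1` B) = nu B ;
    marginal_base : forall A, measurable A -> nu (A `*` setT) = P A }.

Record sample_measures (d : measure_display)
    (Omega : measurableType d) (R : realType) (P : probability Omega R)
    (p : nat) (theta : Omega -> Omega) (b : Omega -> nat)
    (a : Omega -> 'M[bool]_p.+1)
    (nu : probability (Omega * shift_space p)%type R)
    (mu : Omega -> probability (shift_space p) R) : Prop :=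
  SampleMeasures {
    measurable_samples : forall A, measurable A ->
      measurable_fun setT (mu ^~ A) ;
    disintegration : forall B, measurable B ->
      nu B = (\int[P]_w mu w (xsection B w))%E ;
    carried_by_fiber : {ae P, forall w, mu w (fiber theta b a w) = 1%E} }.

Definition mean_measure (d : measure_display)
    (Omega : measurableType d) (R : realType) (P : probability Omega R)
    (p : nat) (mu : Omega -> probability (shift_space p) R)
    (A : set (shift_space p)) : \bar R :=
  (\int[P]_w mu w A)%E.

Definition lower_H2 (R : realType) (p : nat)
    (m : set (shift_space p) -> \bar R) : \bar R :=
  limn_einf (fun k =>
    (lne (\sum_(u : k.-tuple 'I_p.+1) m (word_cylinder u) ^+ 2)
       / (- k%:R)%:E)%E).

Definition lower_h0 (d : measure_display) (Omega : measurableType d)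
    (R : realType) (P : probability Omega R)
    (p : nat) (mu : Omega -> probability (shift_space p) R) : \bar R :=
  limn_einf (fun k =>
    (lne (\int[P]_w
            \big[maxe/0]_(u : k.-tuple 'I_p.+1) mu w (word_cylinder u))
       / (- k%:R)%:E)%E).

(* The match is on positions i + 1, ..., i + m and j + 1, ..., j + m, so that
   the coordinate 0 is never used. *)
Definition common_substring (p n : nat) (x y : nat -> 'I_p.+1) (m : nat) :
    bool :=
  [exists i : 'I_(n - m).+1, exists j : 'I_(n - m).+1,
    forall k : 'I_m, x (i + k.+1)%N == y (j + k.+1)%N].

Definition longest_match (p n : nat) (x y : nat -> 'I_p.+1) : nat :=
  \max_(m < n.+1 | common_substring n x y m) m.

(* Main.v *)
(* Fix c < H/2, where H is the lower Rényi entropy of mu. By equivariance of the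
   sample measures, the mean probability that x and y carry the same k-word at
   the positions i and j is the integral of \sum_C mu_w(C) mu_(theta^m w)(C)
   over the base, with m = |i - j|. For m of order at least k, the two mixing
   conditions compare it with \sum_C mu(C)^2, roughly exp(- H k). For smaller
   m, it is at most the integral of max_C mu_w(C), roughly exp(- h_0 k); this
   is only exp(- H k / 2), but a window of length n contains O(n k) such pairs
   instead of n^2. With n = exp(c k) the sum over all pairs is summable in k,
   so by Borel-Cantelli, almost surely, no k-match with k large occurs within
   a window of length exp(c k), and the limsup is at most 1/c. *)
Require Import Defs.
From HB Require Import structures.
From mathcomp Require Import all_boot all_order all_algebra.
From mathcomp Require Import all_classical all_reals all_analysis.
From mathcomp Require Import measurable_realfun.
From mathcomp Require Import zify ring lra.
Import Order.TTheory GRing.Theory Num.Theory.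
Import numFieldNormedType.Exports.
Local Open Scope classical_set_scope.
Local Open Scope ring_scope.

(** * Cylinders, the left shift and their measurability *)

Section shift.
Local Set Implicit Arguments.
Variable p : nat.
Implicit Types k i : nat.

Lemma measurable_cylinder k (y : nat -> 'I_p.+1) :
  measurable (cylinder k y : set (shift_space p)).
Proof. by apply: sub_gen_smallest; exists k => //; exists y. Qed.

Lemma measurable_word_cylinder k (u : k.-tuple 'I_p.+1) :
  measurable (word_cylinder u).
Proof. exact: measurable_cylinder. Qed.

Lemma F0_word_cylinder k (u : k.-tuple 'I_p.+1) : F0 k (word_cylinder u).
Proof. by apply: sub_gen_smallest; exists (nth ord0 u). Qed.

Lemma measurable_left_shift :
  measurable_fun setT (@left_shift p : shift_space p -> shift_space p).
Proof.
apply: (@measurability _ _ (shift_space p) (shift_space p) _ _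
  (\bigcup_n (@cylinders p n)) erefl).
move=> _ [_ [k _ [y _ <-]] <-]; rewrite setTI.
(* The letter dropped by the shift is free, so the preimage of a k-cylinder is a finite union of
   cylinders of length k + 1. *)
rewrite (_ : _ @^-1` _ = \bigcup_(l in [set: 'I_p.+1])
    (cylinder k.+1 (fun i => if i is i'.+1 then y i' else l)
      : set (shift_space p))).
  apply: fin_bigcup_measurable; first exact: finite_finset.
  by move=> l _; exact: measurable_cylinder.
apply/seteqP; split => [x xy|x [l _ xl] i ik].
- by exists (x 0%N) => // -[//|i] ik; exact: xy.
- exact: (xl i.+1).
Qed.

Lemma iter_left_shift i (x : shift_space p) (j : nat) :
  iter i (@left_shift p) x j = x (i + j)%N.
Proof.
elim: i j => // i ih j.
by rewrite iterS /left_shift ih addnS addSn.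
Qed.

Lemma measurable_iter_left_shift i :
  measurable_fun setT (iter i (@left_shift p) : shift_space p -> shift_space p).
Proof.
elim: i => [|i ih]; first exact: measurable_id.
exact: (measurableT_comp measurable_left_shift ih).
Qed.

Lemma trivIset_word_cylinder k :
  trivIset setT (fun u : k.-tuple 'I_p.+1 => word_cylinder u).
Proof.
move=> u v _ _ [x [xu xv]]; apply: eq_from_tnth => i.
by rewrite !(tnth_nth ord0) -xu// -xv.
Qed.

Lemma bigcup_word_cylinder k :
  \bigcup_(u : k.-tuple 'I_p.+1) word_cylinder u = setT.
Proof.
apply/seteqP; split => // x _;
exists [tuple (x i : 'I_p.+1) | i < k] => //= i ik.
have -> : i = Ordinal ik by [].
by rewrite -tnth_nth tnth_mktuple.
Qed.

Lemma sum_word_cylinder (R : realType) (m : probability (shift_space p) R) k :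
  (\sum_(u : k.-tuple 'I_p.+1) m (word_cylinder u) = 1)%E.
Proof.
rewrite -(@probability_setT _ _ _ m) -(bigcup_word_cylinder k).
rewrite measure_fin_bigcup//; last 3 first.
- exact: finite_finset.
- exact: trivIset_word_cylinder.
- by move=> u _; exact: measurable_word_cylinder.
rewrite -big_enum fsbig_seq ?enum_uniq//=.
by apply: eq_fsbigl; apply/seteqP; split => // u _ /=; rewrite mem_enum.
Qed.

End shift.

(** * The base system and the equivariance of the sample measures *)

Section base.
Local Set Implicit Arguments.
Variables (R : realType) (d : measure_display) (Omega : measurableType d).
Variables (P : probability Omega R) (theta : Omega -> Omega).
Hypothesis erg : invertible_ergodic P theta.

Lemma measurable_iter_base i : measurable_fun setT (iter i theta).
Proof.
elim: i => [|i ih]; first exact: measurable_id.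
exact: (measurableT_comp (measurable_base erg) ih).
Qed.

Lemma preserving_iter_base i A :
  measurable A -> P (iter i theta @^-1` A) = P A.
Proof.
elim: i A => // i ih A mA; have := measurable_base erg measurableT mA.
by rewrite setTI => /ih; rewrite (preserving_base erg mA).
Qed.

Lemma integral_iter_base i D (f : Omega -> \bar R) :
  measurable D -> measurable_fun D f -> (forall w, (0 <= f w)%E) ->
  (\int[P]_(w in iter i theta @^-1` D) f (iter i theta w)
    = \int[P]_(w in D) f w)%E.
Proof.
move=> mD mf f0.
rewrite -[LHS](ge0_integral_pushforward (measurable_iter_base i) P mD mf)//.
apply: eq_measure_integral => [|mth A mA _]; first exact: measurable_iter_base.
exact: preserving_iter_base.
Qed.

Variables (p : nat) (b : Omega -> nat) (a : Omega -> 'M[bool]_p.+1).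
Variables (nu : probability (Omega * shift_space p)%type R).
Variable mu : Omega -> probability (shift_space p) R.
Hypothesis inv : invariant_with_marginal P theta b a nu.
Hypothesis dis : sample_measures P theta b a nu mu.

Lemma sample_rectangle B C : measurable B -> measurable C ->
  (nu (B `*` C) = \int[P]_(w in B) mu w C)%E.
Proof.
move=> mB mC; rewrite (disintegration dis); last exact: measurableX.
rewrite [RHS]integral_mkcond; apply: eq_integral => w _; rewrite patchE.
case: ifPn => wB; first by rewrite in_xsectionX.
by rewrite notin_xsectionX// measure0.
Qed.

Lemma iter_skew_shift i w (x : shift_space p) :
  iter i (skew_shift theta) (w, x) = (iter i theta w, iter i (@left_shift p) x).
Proof. by elim: i => // i ih; rewrite iterS ih. Qed.

Lemma measurable_skew_shift : measurable_fun setT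
  (skew_shift theta : Omega * shift_space p -> Omega * shift_space p).
Proof.
apply/measurable_fun_pairP; split.
- exact: (measurableT_comp (measurable_base erg) measurable_fst).
- exact: (measurableT_comp (@measurable_left_shift p) measurable_snd).
Qed.

Lemma iter_skew_shift_invariant i B :
  measurable B -> nu (iter i (skew_shift theta) @^-1` B) = nu B.
Proof.
elim: i B => // i ih B mB; have := measurable_skew_shift measurableT mB.
by rewrite setTI => /ih; rewrite (skew_shift_invariant inv mB).
Qed.

Lemma measurable_sample_iter i C : measurable C ->
  measurable_fun setT (fun w => mu (iter i theta w) C).
Proof.
move=> mC.
exact: (measurableT_comp (measurable_samples dis mC) (measurable_iter_base i)).
Qed.

Lemma measurable_shift_preimage i C :
  measurable C -> measurable (iter i (@left_shift p) @^-1` C).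
Proof.
move=> mC; rewrite -[X in measurable X]setTI.
exact: measurable_iter_left_shift.
Qed.

Lemma measurable_sample_shift i C : measurable C ->
  measurable_fun setT (fun w => mu w (iter i (@left_shift p) @^-1` C)).
Proof.
by move=> mC; exact: (measurable_samples dis (measurable_shift_preimage i mC)).
Qed.

(* Invertibility of [theta] makes every base set a preimage under [theta^i], so
   that invariance of [nu] on rectangles identifies both densities. *)
Lemma sample_equivariant i C : measurable C ->
  {ae P, forall w,
    mu w (iter i (@left_shift p) @^-1` C) = mu (iter i theta w) C}.
Proof.
move=> mC; have mS := measurable_shift_preimage i mC.
suff : ae_eq P setT (fun w => mu w (iter i (@left_shift p) @^-1` C))
    (fun w => mu (iter i theta w) C).
  by apply: filterS => w; exact.
apply: integral_ae_eq => //.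
- apply/integrableP; split; first exact: measurable_sample_shift.
  apply: (@le_lt_trans _ _ (\int[P]_w (cst 1%E w))%E).
    apply: ge0_le_integral => //.
    + by apply: measurableT_comp => //; exact: measurable_sample_shift.
    + by move=> w _; rewrite gee0_abs// probability_le1.
  rewrite integral_cst// mul1e.
  by rewrite (le_lt_trans (probability_le1 P measurableT))// ltry.
- exact: measurable_sample_iter.
- move=> E _ mE; have [thV mthV [thK thVK]] := invertible_base erg.
  have mV : measurable (iter i thV @^-1` E).
    elim: i {mS} E mE => // i ih E mE.
    have := ih _ (mthV measurableT _ mE).
    by rewrite setTI.
  have EV : E = iter i theta @^-1` (iter i thV @^-1` E).
    apply/seteqP.
    suff K w : iter i thV (iter i theta w) = w by split => w /=; rewrite K.
    by elim: i {mS mV} => // i ih; rewrite iterSr iterS thK ih.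
  rewrite -sample_rectangle// [in RHS]EV.
  rewrite (@integral_iter_base i _ (fun w => mu w C))//; last first.
    exact/measurable_funTS/(measurable_samples dis).
  rewrite -sample_rectangle// -[RHS](iter_skew_shift_invariant i); last first.
    exact: measurableX.
  rewrite [in LHS]EV; congr (nu _).
  by apply/seteqP; split => -[w x]; rewrite /= iter_skew_shift.
Qed.

End base.

(** Finiteness is asked of [x] only: an infinite [y] would lie at infinite distance from it. *)
Lemma le_add_of_dist {R : realType} {x y : \bar R} {e : R} :
  x \is a fin_num -> (`|x - y| <= e%:E)%E ->
  (y <= x + e%:E)%E /\ (x <= y + e%:E)%E.
Proof.
case: x => // x _; case: y => [y||]//=.
by rewrite !lee_fin ler_distl => /andP[]; lra.
Qed.

(** * Mean probability of equal words at two positions *)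

Section overlap.
Local Set Implicit Arguments.
Local Unset Strict Implicit.
Variables (R : realType) (d : measure_display) (Omega : measurableType d).
Variables (P : probability Omega R) (theta : Omega -> Omega).
Hypothesis erg : invertible_ergodic P theta.
Variables (p : nat) (b : Omega -> nat) (a : Omega -> 'M[bool]_p.+1).
Variables (nu : probability (Omega * shift_space p)%type R).
Variable mu : Omega -> probability (shift_space p) R.
Hypothesis inv : invariant_with_marginal P theta b a nu.
Hypothesis dis : sample_measures P theta b a nu mu.
Local Open Scope ereal_scope.
Notation sigma i := (iter i (@left_shift p)).

(** Distinct words exclude each other, so this is the probability that two independent points drawn
    from [mu w] carry the same k-word, one at position i and the other at position j. *)
Definition match_weight k i j (w : Omega) :=
  \sum_(u : k.-tuple 'I_p.+1)
    mu w (sigma i @^-1` word_cylinder u) * mu w (sigma j @^-1` word_cylinder u).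

Definition overlap k m :=
  \int[P]_w \sum_(u : k.-tuple 'I_p.+1)
    mu w (word_cylinder u) * mu (iter m theta w) (word_cylinder u).

Let measurable_sample k (u : k.-tuple 'I_p.+1) :
  measurable_fun setT (fun w => mu w (word_cylinder u)).
Proof. exact: (measurable_samples dis (measurable_word_cylinder u)). Qed.

Let measurable_product k m (u : k.-tuple 'I_p.+1) : measurable_fun setT
  (fun w => mu w (word_cylinder u) * mu (iter m theta w) (word_cylinder u)).
Proof.
apply: emeasurable_funM; first exact: measurable_sample.
exact: (measurable_sample_iter erg dis m (measurable_word_cylinder u)).
Qed.

Lemma measurable_match_weight k i j : measurable_fun setT (match_weight k i j).
Proof.
apply: emeasurable_sum => u; have mC := measurable_word_cylinder u.
by apply: emeasurable_funM; exact: (measurable_sample_shift dis).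
Qed.

Lemma match_weight_ge0 k i j w : 0 <= match_weight k i j w.
Proof. by apply: sume_ge0 => u _; apply: mule_ge0. Qed.

Lemma match_weightC k i j : match_weight k i j = match_weight k j i.
Proof. by apply/funext => w; apply: eq_bigr => u _; rewrite muleC. Qed.

(** Equivariance moves the two positions into the base points [theta^i w] and [theta^(i + m) w];
    invariance of [P] under [theta^i] then leaves only the distance m. *)
Lemma integral_match_weight k i m :
  \int[P]_w match_weight k i (i + m) w = overlap k m.
Proof.
rewrite /overlap -(@integral_iter_base _ _ _ _ _ erg i setT (fun w =>
  \sum_(u : k.-tuple 'I_p.+1)
    mu w (word_cylinder u) * mu (iter m theta w) (word_cylinder u)))//;
  last 2 first.
- by apply: emeasurable_sum => u; exact: measurable_product.
- by move=> w; apply: sume_ge0 => u _; apply: mule_ge0.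
apply: ge0_ae_eq_integral => //.
- exact: measurable_match_weight.
- apply: emeasurable_sum => u.
  have := measurable_product m u.
  move=> /(fun h => measurableT_comp h (measurable_iter_base erg i)); exact.
- by move=> w _; exact: match_weight_ge0.
- by move=> w _; apply: sume_ge0 => u _; apply: mule_ge0.
(* The null set of equivariance depends on the word. Numbering the words by rank makes the
   exceptional sets a sequence; ranks beyond the number of words give a vacuous condition. *)
have /ae_foralln : forall n, {ae P, forall w, forall u : k.-tuple 'I_p.+1,
    enum_rank u = n :> nat ->
  mu w (sigma i @^-1` word_cylinder u)
    = mu (iter i theta w) (word_cylinder u) /\
  mu w (sigma (i + m) @^-1` word_cylinder u)
    = mu (iter (i + m) theta w) (word_cylinder u)}.
  move=> n; have [nk|kn] := ltnP n #|{: k.-tuple 'I_p.+1}|; last first.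
    by apply: aeW => w u un; move: kn; rewrite -un leqNgt ltn_ord.
  have mC := measurable_word_cylinder (enum_val (Ordinal nk)).
  apply: filterS2 (sample_equivariant erg inv dis i mC)
    (sample_equivariant erg inv dis (i + m) mC).
  move=> w h1 h2 u un; suff <- : enum_val (Ordinal nk) = u by [].
  by rewrite -[RHS]enum_rankK; congr enum_val; apply/val_inj.
apply: filterS => w h _; apply: eq_bigr => u _.
have [-> ->] := h _ u erefl.
by rewrite (addnC i m) iterD.
Qed.

Lemma measurable_max_sample k : measurable_fun setT
  (fun w => \big[maxe/0]_(u : k.-tuple 'I_p.+1) mu w (word_cylinder u)).
Proof.
suff mmax (s : seq (k.-tuple 'I_p.+1)) : measurable_fun setT
  (fun w => \big[maxe/0]_(u <- s) mu w (word_cylinder u)) by exact: mmax.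
elim: s => [|u s ih].
  by apply: eq_measurable_fun (measurable_cst 0) => w _; rewrite big_nil.
apply: eq_measurable_fun (measurable_maxe (measurable_sample u) ih) => w _.
by rewrite big_cons.
Qed.

(** One factor is bounded by the maximum; the other sums to 1, since the cylinders partition the
    space. *)
Lemma overlap_le_max k m :
  overlap k m <=
  \int[P]_w \big[maxe/0]_(u : k.-tuple 'I_p.+1) mu w (word_cylinder u).
Proof.
apply: ge0_le_integral => //.
- by move=> w _; apply: sume_ge0 => u _; apply: mule_ge0.
- by apply: emeasurable_sum => u; exact: measurable_product.
- exact: measurable_max_sample.
move=> w _; set M := \big[maxe/0]_u _.
rewrite -[M]mule1 -(sum_word_cylinder (mu (iter m theta w)) k).
rewrite ge0_sume_distrr//; apply: lee_sum => u _.
by rewrite lee_wpmul2r//; apply: le_bigmax.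
Qed.

Variable alpha : nat -> R.
Hypothesis mean_mixing : forall (n g : nat) (B : set (shift_space p)), F0 n B ->
  `| mean_measure P mu (B `&` sigma (g + n) @^-1` B)
     - mean_measure P mu B ^+ 2 | <= (alpha g)%:E.
Hypothesis sample_mixing : forall (n m g : nat) (B C : set (shift_space p)),
  F0 n B -> F0 m C -> {ae P, forall w,
    `| mu w (B `&` sigma (g + n) @^-1` C)
       - mu w B * mu (iter (n + g) theta w) C | <= (alpha g)%:E}.

Lemma mean_measure_fin B : measurable B -> mean_measure P mu B \is a fin_num.
Proof.
move=> mB; rewrite ge0_fin_numE; last by apply: integral_ge0.
apply: (@le_lt_trans _ _ (\int[P]_w (cst 1 w))).
  apply: ge0_le_integral => //; first exact: (measurable_samples dis).
  by move=> w _; exact: probability_le1.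
rewrite integral_cst// mul1e.
by rewrite (le_lt_trans (probability_le1 P measurableT))// ltry.
Qed.

(** Two k-words at distance g + k are separated by a gap g. Sample mixing turns each product into
    the measure of an intersection, which integrates to its mean measure; mean mixing turns that
    into a square. Each of the [p.+1 ^ k] words pays [alpha g] twice. *)
Lemma overlap_le_mixing k g :
  overlap k (g + k) <=
  \sum_(u : k.-tuple 'I_p.+1) mean_measure P mu (word_cylinder u) ^+ 2
  + (2 * (p.+1%:R ^+ k * alpha g))%:E.
Proof.
rewrite /overlap ge0_integral_sum//; last first.
  by move=> u w _; apply: mule_ge0.
have -> : (2 * (p.+1%:R ^+ k * alpha g))%:E
    = \sum_(u : k.-tuple 'I_p.+1) (alpha g + alpha g)%:E.
  rewrite sumEFin; congr EFin.
  rewrite sumr_const card_tuple card_ord -[RHS]mulr_natl natrX; lra.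
rewrite -big_split/=; apply: lee_sum => u _.
have mC := measurable_word_cylinder u; have FC := F0_word_cylinder u.
have mS := measurable_shift_preimage (g + k) mC.
have mCS : measurable (word_cylinder u `&` sigma (g + k) @^-1` word_cylinder u).
  exact: measurableI.
have a0 : 0 <= (alpha g)%:E.
  exact: le_trans (mean_mixing g FC).
apply: (@le_trans _ _ (\int[P]_w
  (mu w (word_cylinder u `&` sigma (g + k) @^-1` word_cylinder u)
   + (alpha g)%:E))).
  apply: ae_ge0_le_integral => //.
  - by move=> w _; apply: mule_ge0.
  - by move=> w _; apply: adde_ge0.
  - by apply: emeasurable_funD => //; exact: (measurable_samples dis).
  apply: filterS (sample_mixing g FC FC) => w h _.
  rewrite (addnC k g) in h.
  by case: (le_add_of_dist _ h) => //; exact: fin_num_measure.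
rewrite ge0_integralD//; last exact: (measurable_samples dis).
rewrite integral_cst// [X in _ * X](@probability_setT _ _ _ P) mule1.
rewrite EFinD [leRHS]addeA leeD2r//.
by case: (le_add_of_dist _ (mean_mixing g FC)) => //; exact: mean_measure_fin.
Qed.

End overlap.

(** * Exponential rates, counting near the diagonal, and series *)

Lemma lower_rate_bound {R : realType} {s : nat -> \bar R} {h : R} :
  (forall k, (0 <= s k)%E) ->
  (h%:E < limn_einf (fun k => lne (s k) / (- k%:R)%:E))%E ->
  \forall k \near \oo, (s k <= (expR (- (h * k%:R)))%:E)%E.
Proof.
move=> s0; rewrite /limn_einf lteNr => /ereal_inf_lt[_ [V Voo <-]] Vh.
near=> k.
have kV : V k by near: k.
have k0 : 0 < k%:R :> R by rewrite ltr0n; near: k; exists 1%N.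
have : (- (lne (s k) / (- k%:R)%:E) < - h%:E)%E.
  by apply: le_lt_trans Vh; apply: ereal_sup_ubound; exists k.
rewrite lteN2 inver oppr_eq0 gt_eqF//.
(* A zero term satisfies the bound trivially; an infinite one would have rate minus infinity, which
   cannot exceed [h]. *)
case: (s k) (s0 k) => [r||]//; rewrite ?lee_fin.
- rewrite le_eqVlt => /predU1P[<- _|r0]; first exact: expR_ge0.
  rewrite lne_EFin// lte_fin => hr.
  rewrite -[leLHS]lnK ?posrE// ler_expR ltW//.
  by move: hr; rewrite invrN mulrN ltrNr ltr_pdivrMr// mulNr.
- by move=> _ /=; rewrite invrN lt0_mulye// lte_fin oppr_lt0 invr_gt0.
Unshelve. all: by end_near. Qed.

Lemma limn_esup_le {R : realType} {u : nat -> \bar R} {l : \bar R} :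
  (\forall n \near \oo, (u n <= l)%E) -> (limn_esup u <= l)%E.
Proof.
move=> ul; apply: (@le_trans _ _ (ereal_sup (u @` [set n | (u n <= l)%E]))).
  by apply: ereal_inf_lbound; exists [set n | (u n <= l)%E].
by apply: ge_ereal_sup => _ [n /= un <-].
Qed.

(** The indices counted are distinct and lie among the 2 D consecutive integers from the truncated
    difference [i - D] on. *)
Lemma sum_window (N D i : nat) :
  (\sum_(j < N) ((i < j + D) && (j < i + D)) <= 2 * D)%N.
Proof.
rewrite -big_mkcond/=.
rewrite -(big_mkord (fun j => (i < j + D) && (j < i + D))%N (fun=> 1%N))/=.
rewrite sum1_count -size_filter mul2n -addnn.
rewrite -[leqRHS](size_iota (i - D)); apply: uniq_leq_size.
  by rewrite filter_uniq// iota_uniq.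
move=> j; rewrite mem_filter mem_iota => /andP[/andP[ij ji] _]; lia.
Qed.

Lemma measure_bigcup_fin_le {R : realType} {d} {T : measurableType d}
    (m : {measure set T -> \bar R}) (I : finType) (F : I -> set T) :
  (forall i, measurable (F i)) ->
  (m (\bigcup_i F i) <= \sum_i m (F i))%E.
Proof.
move=> mF; have -> : \bigcup_i F i = \bigcup_(i in [set` index_enum I]) F i.
  by congr bigcup; apply/seteqP; split => // i _ /=; exact: mem_index_enum.
rewrite bigcup_seq; elim: (index_enum I) => [|i s ih].
  by rewrite !big_nil measure0.
rewrite !big_cons; apply: le_trans (leeD2l _ ih).
by apply: measureU2 => //; exact: bigsetU_measurable.
Qed.

Lemma geometric_nneseries_lty {R : realType} (K z : R) :
  0 <= K -> 0 <= z < 1 -> (\sum_(k <oo) (K * z ^+ k)%:E < +oo)%E.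
Proof.
move=> K0 /andP[z0 z1];
apply: (@le_lt_trans _ _ (K / (1 - z))%:E); last exact: ltry.
apply: lime_le.
  by apply: is_cvg_nneseries => k _ _; rewrite lee_fin mulr_ge0// exprn_ge0.
apply: nearW => n; rewrite sumEFin lee_fin.
rewrite -[leLHS]/(series (geometric K z) n) geometric_seriesE ?lt_eqF//=.
by rewrite ler_pM2r ?invr_gt0 ?subr_gt0// ler_piMr// gerBl exprn_ge0.
Qed.

(** * Match events and the longest common substring *)

Section matching.
Local Set Implicit Arguments.
Variable p : nat.
Notation sigma i := (iter i (@left_shift p)).

(** Fixing the common word besides the two positions makes the event a rectangle, on which a product
    measure factorises. *)
Definition match_rectangle k N (t : 'I_N * 'I_N * k.-tuple 'I_p.+1) :
    set (shift_space p * shift_space p) :=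
  (sigma t.1.1 @^-1` word_cylinder t.2) `*`
  (sigma t.1.2 @^-1` word_cylinder t.2).

Definition match_set k N := \bigcup_t @match_rectangle k N t.

Lemma measurable_match_rectangle k N (t : 'I_N * 'I_N * k.-tuple 'I_p.+1) :
  measurable (match_rectangle t).
Proof.
by apply: measurableX; apply: measurable_shift_preimage;
  exact: measurable_word_cylinder.
Qed.

Lemma measurable_match_set k N : measurable (match_set k N).
Proof.
apply: fin_bigcup_measurable => [|t _]; first exact: finite_finset.
exact: measurable_match_rectangle.
Qed.

Lemma match_setS k N N' : (N <= N')%N -> match_set k N `<=` match_set k N'.
Proof.
move=> NN' xy [[[i j] u] _ ijxy].
by exists (widen_ord NN' i, widen_ord NN' j, u).
Qed.

Lemma match_set_longest n (x y : shift_space p) :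
  match_set (longest_match n x y) n.+2 (x, y).
Proof.
rewrite /longest_match.
have [|m cm ->] := @eq_bigmax_cond _
  [pred m : 'I_n.+1 | common_substring n x y m] (fun m => m : nat).
  (* The empty word always matches, so the maximum is attained. *)
  apply/card_gt0P; exists ord0; rewrite inE.
  apply/existsP; exists ord0; apply/existsP; exists ord0.
  by apply/forallP => -[].
have {cm} /existsP[i /existsP[j /forallP xy]] : common_substring n x y m by [].
(* The match starts at coordinate i + 1, not i, and i is at most n - m; hence the window n + 2. *)
have in_ (i' : 'I_(n - m).+1) : (i'.+1 < n.+2)%N.
  by have := ltn_ord i'; lia.
exists (Ordinal (in_ i), Ordinal (in_ j),
  [tuple (x (i + l.+1)%N : 'I_p.+1) | l < m]) => //.
split=> l lm; rewrite [LHS]iter_left_shift [RHS](nth_mktuple _ _ (Ordinal lm)).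
  by rewrite addSnnS.
by rewrite addSnnS (eqP (xy (Ordinal lm))).
Qed.

(** The added 2 is the window enlargement of [match_set_longest]: every n up to [expR (c * k)] has n
    + 2 at most the cutoff. *)
Definition cutoff {R : realType} (c : R) (k : nat) : nat :=
  (Num.truncn (expR (c * k%:R))).+2.

Lemma cutoff_le {R : realType} (c : R) k :
  0 < c -> (cutoff c k)%:R <= 3 * expR (c * k%:R).
Proof.
move=> c0; rewrite /cutoff -addn2 natrD.
have e1 : 1 <= expR (c * k%:R) by rewrite -expR0 ler_expR mulr_ge0// ltW.
have : (Num.truncn (expR (c * k%:R)))%:R <= expR (c * k%:R).
  by rewrite truncn_le expR_ge0.
lra.
Qed.

(** Take for k the longest match length m itself. If m is at least [K] and n were below
    [expR (c * m)], the match would lie in the forbidden window of order m; so c m is at most ln n.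
    Lengths below [K] are harmless once n exceeds [expR (c * K)]. *)
Lemma longest_match_limsup {R : realType} (c : R) (x y : shift_space p) :
  0 < c ->
  (exists K, forall k, (K <= k)%N -> ~ match_set k (cutoff c k) (x, y)) ->
  (limn_esup (fun n => ((longest_match n x y)%:R / ln n%:R)%:E)
    <= (c^-1)%:E)%E.
Proof.
move=> c0 [K nomatch]; apply: limn_esup_le; near=> n.
have n2 : (2 <= n)%N by near: n; exists 2%N.
have nK : expR (c * K%:R) <= n%:R :> R by near: n; exact: nbhs_infty_ger.
have n0 : 0 < n%:R :> R by rewrite ltr0n; lia.
have ln0 : 0 < ln n%:R :> R by rewrite ln_gt0// ltr1n.
rewrite lee_fin ler_pdivrMr// ler_pdivlMl//.
have [mK|Km] := ltnP (longest_match n x y) K.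
  apply: (@le_trans _ _ (c * K%:R)); first by rewrite ler_pM2l// ler_nat ltnW.
  by rewrite -[leLHS]expRK ler_ln// posrE expR_gt0.
rewrite -[leLHS]expRK ler_ln ?posrE ?expR_gt0// leNgt; apply/negP => nm.
apply: (nomatch _ Km); apply: match_setS (match_set_longest n x y).
by rewrite !ltnS truncn_ge_nat ?expR_ge0// ltW.
Unshelve. all: by end_near. Qed.

End matching.

(** * First moment estimates and the Borel-Cantelli argument *)

Section almost_sure_matching.
Local Set Implicit Arguments.
Local Unset Strict Implicit.
Variables (R : realType) (d : measure_display) (Omega : measurableType d).
Variables (P : probability Omega R) (theta : Omega -> Omega).
Hypothesis erg : invertible_ergodic P theta.
Variables (p : nat) (b : Omega -> nat) (a : Omega -> 'M[bool]_p.+1).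
Variables (nu : probability (Omega * shift_space p)%type R).
Variable mu : Omega -> probability (shift_space p) R.
Hypothesis inv : invariant_with_marginal P theta b a nu.
Hypothesis dis : sample_measures P theta b a nu mu.

(** The expected number of pairs of positions below N at which two independent points drawn from
    [mu w] carry equal k-words. *)
Definition total_weight k N (w : Omega) : \bar R :=
  (\sum_(i < N) \sum_(j < N) match_weight mu k i j w)%E.

Lemma measurable_total_weight k N : measurable_fun setT (total_weight k N).
Proof.
apply: emeasurable_sum => i; apply: emeasurable_sum => j.
exact: (measurable_match_weight dis).
Qed.

Lemma total_weight_ge0 k N w : (0 <= total_weight k N w)%E.
Proof.
by apply: sume_ge0 => i _; apply: sume_ge0 => j _; exact: match_weight_ge0.
Qed.

Lemma product_match_set_le k N w :
  ((mu w \x mu w) (match_set k N) <= total_weight k N w)%E.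
Proof.
apply: le_trans
  (measure_bigcup_fin_le _ _ _ (@measurable_match_rectangle p k N)) _.
rewrite /total_weight pair_bigA/= /match_weight pair_bigA/=.
apply: lee_sum => -[[i j] u] _ /=.
by rewrite product_measure1E//;
  apply: measurable_shift_preimage; exact: measurable_word_cylinder.
Qed.

(** One of the two truncated differences vanishes, so their sum is the distance of i and j; symmetry
    reduces to i at most j. *)
Lemma integral_match_weight_dist k i j :
  (\int[P]_w match_weight mu k i j w
    = overlap P theta mu k ((i - j) + (j - i)))%E.
Proof.
wlog ij : i j / (i <= j)%N => [hw|].
  have [|/ltnW ji] := leqP i j; first exact: hw.
  by rewrite match_weightC hw// addnC.
have -> : ((i - j) + (j - i) = j - i)%N by lia.
by rewrite -(integral_match_weight erg inv dis k i) subnKC.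
Qed.

(** All pairs are charged [B], and those at distance less than [D], at most 2 D for each i, are
    charged [S] in addition. *)
Lemma integral_total_weight k N D (B S : R) : 0 <= B -> 0 <= S ->
  (forall m, overlap P theta mu k m <= S%:E)%E ->
  (forall m, (D <= m)%N -> overlap P theta mu k m <= B%:E)%E ->
  (\int[P]_w total_weight k N w
    <= (N%:R ^+ 2 * B + N%:R * (2 * D)%:R * S)%:E)%E.
Proof.
move=> B0 S0 hS hB; rewrite /total_weight ge0_integral_sum//; last 2 first.
- move=> i; apply: emeasurable_sum => j.
  exact: (measurable_match_weight dis).
- by move=> i w _; apply: sume_ge0 => j _; exact: match_weight_ge0.
apply: (@le_trans _ _ (\sum_(i < N) (N%:R * B + (2 * D)%:R * S)%:E)%E);
  last first.
  rewrite sumEFin lee_fin sumr_const card_ord -[leLHS]mulr_natl.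
  by rewrite mulrDr expr2 !mulrA.
apply: lee_sum => i _; rewrite ge0_integral_sum//; last 2 first.
- by move=> j; exact: (measurable_match_weight dis).
- by move=> j w _; exact: match_weight_ge0.
apply: (@le_trans _ _ (\sum_(j < N)
    (B + ((i < j + D) && (j < i + D))%N%:R * S)%:E)%E).
  apply: lee_sum => j _; rewrite integral_match_weight_dist.
  have [near_diag|far] := boolP ((i < j + D) && (j < i + D))%N.
    by apply: le_trans (hS _) _; rewrite lee_fin mul1r lerDr.
  by rewrite mul0r addr0; apply: hB; lia.
rewrite sumEFin lee_fin big_split/= sumr_const card_ord -[_ *+ N]mulr_natl.
rewrite lerD2l -mulr_suml -natr_sum ler_wpM2r// ler_nat.
exact: sum_window.
Qed.

Variables (rho : R) (alpha : nat -> R).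
Hypothesis rho01 : 0 <= rho < 1.
Hypothesis alphaO : alpha =O_\oo (fun g => rho ^+ g).
Notation sigma i := (iter i (@left_shift p)).
Hypothesis mean_mixing : forall (n g : nat) (B : set (shift_space p)), F0 n B ->
  (`| mean_measure P mu (B `&` sigma (g + n) @^-1` B)
     - mean_measure P mu B ^+ 2 | <= (alpha g)%:E)%E.
Hypothesis sample_mixing : forall (n m g : nat) (B C : set (shift_space p)),
  F0 n B -> F0 m C -> {ae P, forall w,
    (`| mu w (B `&` sigma (g + n) @^-1` C)
       - mu w B * mu (iter (n + g) theta w) C | <= (alpha g)%:E)%E}.

(* The gap [L * k] is long enough for the mixing error, summed over the
   [p.+1 ^ k] words, to be of the order of [\sum mu(C)^2]. *)
Lemma overlap_far_bound (h : R) : (h%:E < lower_H2 (mean_measure P mu))%E ->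
  exists C : R, exists2 L : nat, 0 <= C & \forall k \near \oo, forall m,
    (L.+1 * k <= m)%N ->
    (overlap P theta mu k m <= (C * expR (- (h * k%:R)))%:E)%E.
Proof.
move=> hH; have /andP[rho0 rho1] := rho01.
have [C C0 [g0 _ alpha_le]] : exists2 C : R, 0 < C &
    \forall g \near \oo, `|alpha g| <= C * `|rho ^+ g|.
  exact/eqO_exP.
have [L L0 Lh] : exists2 L, (0 < L)%N & p.+1%:R * rho ^+ L <= expR (- h).
  have : \forall L \near \oo, `|rho ^+ L| < expR (- h) / p.+1%:R.
    have e0 : 0 < expR (- h) / p.+1%:R :> R by rewrite divr_gt0 ?expR_gt0.
    have rho_cvg : rho ^+ n @[n --> \oo] --> 0.
      by apply: cvg_expr; rewrite ger0_norm.
    exact: (cvgr0_norm_lt _ rho_cvg _ e0).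
  move=> [L0 _ hL]; exists L0.+1 => //.
  have /= := hL L0.+1 (leqnSn _); rewrite ger0_norm ?exprn_ge0// => /ltW.
  by rewrite ler_pdivlMr// mulrC.
exists (1 + 2 * C), L; first by rewrite addr_ge0// mulr_ge0// ltW.
have := lower_rate_bound _ hH => /(_ _)/wrap[].
  by move=> k; apply: sume_ge0 => u _; exact: sqre_ge0.
move=> [k1 _ Hk1]; near=> k => m Lm.
have -> : m = (m - k + k)%N by lia.
apply: le_trans (overlap_le_mixing erg dis mean_mixing sample_mixing k _) _.
have kk1 : (k1 <= k)%N by near: k; exists k1.
have kg : (g0 <= k)%N by near: k; exists g0.
have -> : (1 + 2 * C) * expR (- (h * k%:R))
    = expR (- (h * k%:R)) + 2 * (C * expR (- (h * k%:R))) by lra.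
rewrite [leRHS]EFinD; apply: leeD; first exact: Hk1.
rewrite lee_fin ler_pM2l//.
have mkL : (L * k <= m - k)%N by lia.
(* As [L] is positive, the gap [m - k] is at least k, hence large enough for the bound on
   [alpha]. *)
have := alpha_le (m - k)%N => /(_ _)/wrap[].
  by rewrite /=; nia.
move=> /(le_trans (ler_norm _)); rewrite ger0_norm ?exprn_ge0// => am.
have rr : rho ^+ (m - k) <= rho ^+ (L * k) by rewrite ler_wiXn2l// ltW.
apply: (@le_trans _ _ (p.+1%:R ^+ k * (C * rho ^+ (L * k)))).
  rewrite ler_pM2l ?exprn_gt0//; apply: le_trans am _.
  by rewrite ler_pM2l.
rewrite mulrCA ler_pM2l// exprM -exprMn.
apply: (@le_trans _ _ (expR (- h) ^+ k)).
  by rewrite lerXn2r// ?nnegrE ?expR_ge0// mulr_ge0// exprn_ge0.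
by rewrite -expRM_natr mulNr.
Unshelve. all: by end_near. Qed.

Lemma total_weight_bound (c q : R) : 0 < c -> 0 < q ->
  ((2 * c + 4 * q)%:E < lower_H2 (mean_measure P mu))%E ->
  ((c + 2 * q)%:E < lower_h0 P mu)%E ->
  exists2 K : R, 0 <= K & \forall k \near \oo,
    (\int[P]_w total_weight k (cutoff c k) w <= (K * expR (- q) ^+ k)%:E)%E.
Proof.
move=> c0 q0 cH ch.
have [C [L C0 far]] := overlap_far_bound cH.
(* With x = exp(c k) and z = exp(- q k), the window is at most 3 x, far overlaps at most C (z^2 /
   x)^2 and near ones at most z^2 / x. The far pairs contribute at most 9 C z^4, the near ones at
   most 6 (L + 1) k z^2. *)
exists (9 * C + 6 * L.+1%:R / q).
  by rewrite addr_ge0 ?divr_ge0 ?mulr_ge0//; exact: ltW.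
have := lower_rate_bound _ ch => /(_ _)/wrap[].
  by move=> k; apply: integral_ge0 => w _; exact: bigmax_ge_id.
move=> short; near=> k.
have far_k : forall m, (L.+1 * k <= m)%N -> (overlap P theta mu k m <=
    (C * expR (- ((2 * c + 4 * q) * k%:R)))%:E)%E by near: k.
have short_k m : (overlap P theta mu k m
    <= (expR (- ((c + 2 * q) * k%:R)))%:E)%E.
  by apply: le_trans (overlap_le_max erg dis k m) _; near: k.
apply: le_trans (integral_total_weight (cutoff c k) _ _ short_k far_k) _.
- by rewrite mulr_ge0// expR_ge0.
- exact: expR_ge0.
rewrite lee_fin -expRM_natr; set N := (cutoff c k)%:R.
set x := expR (c * k%:R); set z := expR (- q * k%:R).
have N3 : N <= 3 * x := cutoff_le c k c0.
have N0 : 0 <= N by [].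
have x0 : 0 < x by exact: expR_gt0.
have z0 : 0 < z by exact: expR_gt0.
have z1 : z <= 1 by rewrite -expR0 ler_expR mulNr oppr_le0 mulr_ge0// ltW.
have -> : expR (- ((2 * c + 4 * q) * k%:R)) = (z ^+ 2 / x) ^+ 2.
  rewrite -expRN -!expRM_natr -expRD -expRM_natr; congr expR; lra.
have -> : expR (- ((c + 2 * q) * k%:R)) = z ^+ 2 / x.
  rewrite -expRN -!expRM_natr -expRD; congr expR; lra.
(* One of the two factors z in the near term pays for the linear factor k, because q k is at most
   exp(q k). *)
have kz : k%:R * z <= q^-1.
  rewrite -[leRHS]mul1r ler_pdivlMr// mulrC mulrA.
  rewrite -[leRHS](expRxMexpNx_1 (q * k%:R)).
  rewrite /z mulNr ler_wpM2r ?expR_ge0//.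
  by apply: le_trans (expR_ge1Dx _); rewrite lerDr.
have Nx : N * (z ^+ 2 / x) <= 3 * z ^+ 2.
  by rewrite mulrA ler_pdivrMr// mulrAC ler_pM2r ?exprn_gt0.
have Nx0 : 0 <= N * (z ^+ 2 / x).
  apply: mulr_ge0 => //; apply: divr_ge0; last exact: ltW.
  exact: exprn_ge0 (ltW z0).
rewrite [leRHS]mulrDl; apply: lerD.
  rewrite mulrCA -exprMn (_ : 9 * C * z = C * (9 * z)); last by ring.
  rewrite ler_wpM2l//.
  apply: (@le_trans _ _ ((3 * z ^+ 2) ^+ 2)).
    by rewrite lerXn2r// nnegrE; nra.
  have -> : (3 * z ^+ 2) ^+ 2 = 9 * (z * z ^+ 3) by ring.
  have z31 : z ^+ 3 <= 1 by exact: exprn_ile1 (ltW z0) z1.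
  by rewrite ler_pM2l// ler_piMr//; exact: ltW.
rewrite mulrAC 2!natrM.
apply: (@le_trans _ _ (3 * z ^+ 2 * (2 * (L.+1%:R * k%:R)))).
  by rewrite ler_wpM2r.
have -> : 3 * z ^+ 2 * (2 * (L.+1%:R * k%:R))
    = (6 * L.+1%:R * z) * (k%:R * z) by ring.
have -> : 6 * L.+1%:R / q * z = (6 * L.+1%:R * z) * q^-1 by ring.
by rewrite ler_wpM2l// mulr_ge0// ltW.
Unshelve. all: by end_near. Qed.

(** The total weights have a summable integral, so for almost every w their series converges; it
    dominates the series of match probabilities, and Borel-Cantelli applies in the fibre. *)
Lemma ae_no_match (c q : R) : 0 < c -> 0 < q ->
  ((2 * c + 4 * q)%:E < lower_H2 (mean_measure P mu))%E ->
  ((c + 2 * q)%:E < lower_h0 P mu)%E ->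
  {ae P, forall w, {ae (mu w \x mu w)%E, forall xy,
    exists K, forall k, (K <= k)%N -> ~ @match_set p k (cutoff c k) xy}}.
Proof.
move=> c0 q0 cH ch; have [K K0 [k0 _ bound]] := total_weight_bound c0 q0 cH ch.
(* The moment bound holds only from [k0] on, so the series starts there. *)
pose f k w := total_weight (k + k0) (cutoff c (k + k0)) w.
have mf k : measurable_fun setT (f k) by exact: measurable_total_weight.
have f0 k w : (0 <= f k w)%E by exact: total_weight_ge0.
have fi : P.-integrable setT (fun w => \sum_(k <oo) f k w)%E.
  apply/integrableP; split.
    by apply: ge0_emeasurable_sum.
  under eq_integral => w _ do rewrite gee0_abs ?nneseries_ge0//.
  rewrite integral_nneseries//.
  have e1 : 0 <= expR (- q) < 1 by rewrite expR_ge0 -expR0 ltr_expR oppr_lt0.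
  have K'0 : 0 <= K * expR (- q) ^+ k0.
    by rewrite mulr_ge0// exprn_ge0// expR_ge0.
  apply: le_lt_trans _ (geometric_nneseries_lty _ _ K'0 e1).
  apply: lee_nneseries => [k _ _|k _]; first by apply: integral_ge0.
  by rewrite -mulrA -exprD addnC; apply: bound; rewrite /= leq_addl.
apply: filterS (integrable_ae measurableT fi) => w /(_ I) fw.
pose F k := @match_set p (k + k0) (cutoff c (k + k0)).
have mF k : measurable (F k) by exact: measurable_match_set.
exists (lim_sup_set F); split.
- by apply: bigcap_measurable => // n _; exact: bigcup_measurable.
- apply: lim_sup_set_cvg0 => //.
  apply: (@le_lt_trans _ _ (\sum_(k <oo) f k w)%E).
    by apply: lee_nneseries => // k _; exact: product_match_set_le.
  by rewrite ltey_eq fw.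
move=> xy /= nex n _; apply: contrapT => nF; apply: nex.
exists (n + k0)%N => k nk mk; apply: nF.
exists (k - k0)%N; first by rewrite /=; lia.
by rewrite /F subnK//; lia.
Qed.

End almost_sure_matching.

Theorem theorem2 (R : realType) (d : measure_display)
    (Omega : measurableType d) (P : probability Omega R)
    (theta : Omega -> Omega) (p : nat) (b : Omega -> nat)
    (A : Omega -> 'M[bool]_p.+1)
    (nu : probability (Omega * shift_space p)%type R)
    (mu : Omega -> probability (shift_space p) R) (a : R) (alpha : nat -> R) :
  invertible_ergodic P theta ->
  random_transition_matrix theta b A ->
  invariant_with_marginal P theta b A nu ->
  sample_measures P theta b A nu mu ->
  0 <= a < 1 ->
  alpha =O_\oo (fun g => a ^+ g) ->
  (forall (n g : nat) (B : set (shift_space p)), F0 n B ->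
    (`| mean_measure P mu (B `&` iter (g + n) (@left_shift p) @^-1` B)
        - mean_measure P mu B ^+ 2 | <= (alpha g)%:E)%E) ->
  (forall (n m g : nat) (B C : set (shift_space p)), F0 n B -> F0 m C ->
    {ae P, forall w,
      (`| mu w (B `&` iter (g + n) (@left_shift p) @^-1` C)
          - mu w B * mu (iter (n + g) theta w) C | <= (alpha g)%:E)%E}) ->
  (0 < lower_H2 (mean_measure P mu))%E ->
  (lower_H2 (mean_measure P mu) <= 2%:E * lower_h0 P mu)%E ->
  {ae P, forall w, {ae (mu w \x mu w)%E,
    forall xy : shift_space p * shift_space p,
    (limn_esup (fun n => ((longest_match n xy.1 xy.2)%:R / ln n%:R)%:E)
      <= 2%:E / lower_H2 (mean_measure P mu))%E}}.
Proof.
move=> erg _ inv dis a01 alphaO mean_mix sample_mix.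
set H := lower_H2 _ => H0 Hh.
(* The entropy may be infinite; the target is then 0. *)
have [t t0 tE] : exists2 t : R, 0 <= t & (2%:E / H = t%:E)%E.
  case: H H0 {Hh} => [r||]//; last by exists 0 => //; rewrite invey mule0.
  rewrite lte_fin => r0; exists (2 / r); first by rewrite divr_ge0// ltW.
  by rewrite inver gt_eqF.
pose e n : R := n.+1%:R^-1.
have e0 n : 0 < e n by rewrite invr_gt0.
(* The inverses of these rates decrease to the target, and each rate stays strictly below H / 2. *)
pose c n : R := (t + e n)^-1.
have te n : 0 < t + e n by rewrite ltr_wpDl.
have c0 n : 0 < c n by rewrite invr_gt0.
have cH n : ((2 * c n)%:E < H)%E.
  case: H H0 tE {Hh} => [r||]//; last by move=> _ _; exact: ltry.
  rewrite !lte_fin => r0; rewrite inver gt_eqF// => -[tr].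
  rewrite ltr_pdivrMr// -tr mulrDr mulrCA mulfV ?gt_eqF// mulr1.
  by rewrite ltrDl mulr_gt0.
have match_free n : {ae P, forall w, {ae (mu w \x mu w)%E, forall xy,
    exists K, forall k, (K <= k)%N -> ~ @match_set p k (cutoff (c n) k) xy}}.
  have [q q0 qH] : exists2 q : R, 0 < q & ((2 * c n + 4 * q)%:E < H)%E.
    move: (cH n); case: (H) => [r||]//; last by exists 1 => //; exact: ltry.
    (* The choice makes 2 c + 4 q the midpoint of 2 c and H. *)
    rewrite lte_fin => cr; exists ((r - 2 * c n) / 8); last first.
      by rewrite lte_fin; lra.
    by rewrite divr_gt0// subr_gt0.
  apply: (ae_no_match erg inv dis a01 alphaO mean_mix sample_mix (c0 n) q0 qH).
  (* The hypothesis on H passes the margin to the other entropy: 2 (c + 2 q) < H, which is at most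
     twice [lower_h0]. *)
  rewrite ltNge; apply/negP => hc.
  have := lt_le_trans qH Hh; rewrite ltNge => /negP; apply.
  rewrite (_ : 2 * c n + 4 * q = 2 * (c n + 2 * q)); last by ring.
  by rewrite EFinM lee_pmul2l.
(* Countably many rates suffice, so the exceptional sets can be united, first in the base and then
   in the fibre. *)
apply: filterS (ae_foralln match_free) => w hw.
apply: filterS (ae_foralln hw) => -[x y] hxy /=.
rewrite tE; apply/lee_addgt0Pr => r r0.
apply: (@le_trans _ _ ((c (Num.truncn r^-1))^-1)%:E).
  exact: longest_match_limsup.
rewrite lee_fin invrK lerD2l /e -[leRHS]invrK lef_pV2 ?posrE ?invr_gt0//.
exact/ltW/truncnS_gt.
Qed.
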